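(* For $n\ge1$, $$\sum_{\sigma\in\mathcal D^S_n}(-1)^{\mathrm{inv}(\sigma)}q^{\mathrm{maj}(\sigma)}=[n]_q!\sum_{k=0}^n\frac{(-1)^k q^{\binom k2}}{[k]_q!}\left(\frac{1-q}{1+q}\right)^{\lfloor (n-k)/2\rfloor}.$$
   Context: $\mathcal D^S_n$ is the set of derangements in the symmetric group $S_n$ (permutations $\sigma=\sigma_1\cdots\sigma_n$ of $[n]$ with $\sigma_i\ne i$ for all $i$). $\mathrm{inv}(\sigma)=\#\{(i,j):i<j,\sigma_i>\sigma_j\}$ (the Coxeter length), $\mathrm{maj}(\sigma)=\sum_{i:\sigma_i>\sigma_{i+1}} i$. For an indeterminate $x$ and $m\ge1$, $[m]_x=1+x+\dots+x^{m-1}$, $[0]_x=1$, $[m]_q!=[1]_q\cdots[m]_q$, $[0]_q!=1$. *)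

(* Defs.v *)
From mathcomp Require Import all_boot all_order all_fingroup all_algebra.
Set Implicit Arguments. Unset Strict Implicit. Unset Printing Implicit Defensive.
Import GRing.Theory.
Local Open Scope ring_scope.

(* Permutations of [n] are represented by 'S_n acting on 'I_n = {0,...,n-1};
   position i (0-based) corresponds to position i+1 in the paper. *)

Definition derangement n (s : 'S_n) : bool := [forall i, s i != i].

Definition inv_num n (s : 'S_n) : nat :=
  #|[set p : 'I_n * 'I_n | (p.1 < p.2)%N && (s p.2 < s p.1)%N]|.

(* major index: sum of (1-based) descent positions i with s_i > s_{i+1};
   for 0-based i : 'I_n with i+1 < n the 1-based position is i+1 *)
Definition maj n (s : 'S_n) : nat :=
  \sum_(i : 'I_n) \sum_(j : 'I_n | (j == i.+1 :> nat) && (s j < s i)%N) i.+1.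

Definition qint (R : pzSemiRingType) (q : R) (m : nat) : R :=
  if m == 0%N then 1 else \sum_(i < m) q ^+ i.
Definition qfact (R : pzSemiRingType) (q : R) (m : nat) : R :=
  \prod_(1 <= i < m.+1) qint q i.

Definition ratfun := {fraction {poly rat}}.
Definition qX : ratfun := tofrac ('X : {poly rat}).

(* Main.v *)
(** The sign of a permutation only depends on its cycle type, hence on its
derangement part, the standardisation of its restriction to the non-fixed
points.  So it suffices to know the distribution of [maj] over the
permutations with a given derangement part, and the signed sum over all
permutations.

For the former (Wachs), call a letter small if it lies below its position and
big if it lies above.  Replacing all fixed points by one letter between the
small and the big ones changes no descent, so the permutations of [n] with
derangement part s correspond to the shuffles of a fixed word with a constant
word, and these have generating function q^(maj s) times a q-binomial
coefficient.  Hence A_n = sum_k [n choose k]_q D_k for the signed sums A_n over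
S_n and D_n over derangements, which is inverted by the q-binomial theorem.

For the latter, adding a constant a modulo n+1 to the values of a permutation
of [n+1] that fixes its last point shifts [maj] by n+1-a (if a > 0) and
multiplies the sign by (-1)^(na).  Every permutation arises once in this way,
which gives A_(n+1) = A_n * sum_(a <= n) ((-1)^n q)^a. *)

Require Import Defs.
From mathcomp Require Import all_boot all_order all_fingroup all_algebra.
From mathcomp Require Import zify ring.
Set Implicit Arguments. Unset Strict Implicit. Unset Printing Implicit Defensive.
Import Order.TTheory GRing.Theory Num.Theory.
Local Open Scope ring_scope.

(** * Extension of permutations along an injection *)

Section ExtendPerm.
Variables (T U : finType) (e : T -> U).
Hypothesis e_inj : injective e.

Definition extend_fun (s : {perm T}) (y : U) : U :=
  if [pick x | e x == y] is Some x then e (s x) else y.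

Lemma extend_fun_codom s x : extend_fun s (e x) = e (s x).
Proof.
rewrite /extend_fun; case: pickP => [x' /eqP/e_inj-> // | /(_ x)].
by rewrite eqxx.
Qed.

Lemma extend_fun_out s y : y \notin codom e -> extend_fun s y = y.
Proof.
rewrite /extend_fun; case: pickP => // x /eqP <-.
by rewrite codom_f.
Qed.

Lemma extend_fun_inj s : injective (extend_fun s).
Proof.
move=> y1 y2; have [/codomP[x1 ->]|y1out] := boolP (y1 \in codom e).
  have [/codomP[x2 ->]|y2out] := boolP (y2 \in codom e).
    by rewrite !extend_fun_codom => /e_inj/perm_inj->.
  rewrite extend_fun_codom extend_fun_out // => eq_y2.
  by rewrite -eq_y2 codom_f in y2out.
have [/codomP[x2 ->]|y2out] := boolP (y2 \in codom e).
  rewrite extend_fun_codom extend_fun_out // => eq_y1.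
  by rewrite eq_y1 codom_f in y1out.
by rewrite !extend_fun_out.
Qed.

Definition extend_perm s : {perm U} := perm (@extend_fun_inj s).

Lemma extend_permE s x : extend_perm s (e x) = e (s x).
Proof. by rewrite permE extend_fun_codom. Qed.

Lemma extend_perm_out s y : y \notin codom e -> extend_perm s y = y.
Proof. by move=> yout; rewrite permE extend_fun_out. Qed.

Lemma extend_perm_uniq (s : {perm T}) (p : {perm U}) :
  (forall x, p (e x) = e (s x)) -> (forall y, y \notin codom e -> p y = y) ->
  extend_perm s = p.
Proof.
move=> pE p_out; apply/permP => y.
have [/codomP[x ->]|yout] := boolP (y \in codom e); first by rewrite extend_permE pE.
by rewrite extend_perm_out // p_out.
Qed.

Lemma extend_perm_inj : injective extend_perm.
Proof.
move=> s t eq_st; apply/permP => x; apply: e_inj.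
by rewrite -!extend_permE eq_st.
Qed.

(** A product of transpositions extends to the product of the transpositions of the image points, so
    the number of factors is unchanged. *)
Lemma odd_extend_perm s : extend_perm s = s :> bool.
Proof.
have [ts -> _] := prod_tpermP s.
elim: ts => [|[x y] ts IHts].
  rewrite big_nil; have -> : extend_perm 1%g = 1%g by apply: extend_perm_uniq => *; rewrite !perm1.
  by rewrite !odd_perm1.
rewrite big_cons; set t := (\prod_(t <- ts) _)%g in IHts *.
have -> : extend_perm (tperm x y * t)%g = (tperm (e x) (e y) * extend_perm t)%g.
  apply: extend_perm_uniq => [z|z zout].
    by rewrite !permM -(inj_tperm _ _ _ e_inj) extend_permE.
  rewrite permM tpermD ?extend_perm_out //.
    by apply: contraNneq zout => <-; apply: codom_f.
  by apply: contraNneq zout => <-; apply: codom_f.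
by rewrite !odd_permM !odd_tperm IHts (inj_eq e_inj).
Qed.

Lemma extend_perm_surj (p : {perm U}) :
  (forall y, y \notin codom e -> p y = y) -> exists s, extend_perm s = p.
Proof.
move=> p_out.
have p_codom x : p (e x) \in codom e.
  apply/negPn/negP => out; have /perm_inj p_ex := p_out _ out.
  by rewrite p_ex codom_f in out.
have g_inj : injective (fun x => iinv (p_codom x)).
  move=> x y eq_g; apply/e_inj/(@perm_inj _ p).
  by rewrite -(f_iinv (p_codom x)) eq_g f_iinv.
exists (perm g_inj); apply: extend_perm_uniq => // x.
by rewrite permE f_iinv.
Qed.

(** Serves to trade permutations of [U] that move only points in the image of [e] for permutations
    of [T]: once for a fixed last point, once for a prescribed support. *)
Lemma big_extend_perm (R : Type) (idx : R) (op : Monoid.com_law idx)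
    (P : pred {perm U}) (f : {perm U} -> R) :
  (forall p, P p -> forall y, y \notin codom e -> p y = y) ->
  \big[op/idx]_(p | P p) f p = \big[op/idx]_(s | P (extend_perm s)) f (extend_perm s).
Proof.
move=> P_out.
pose h p := odflt 1%g [pick s | extend_perm s == p].
have extK s : h (extend_perm s) = s.
  rewrite /h; case: pickP => [t /eqP/extend_perm_inj // | /(_ s)].
  by rewrite eqxx.
rewrite (reindex_onto extend_perm h); first by apply: eq_bigl => s; rewrite extK eqxx andbT.
by move=> p /P_out/extend_perm_surj[s <-]; rewrite extK.
Qed.

End ExtendPerm.

(** * Parity of inversions, and the major index of words *)

Lemma odd_inv_num n (s : 'S_n) : odd (inv_num s) = s :> bool.
Proof.
(* Compare the signs of the Vandermonde determinants of 0, ..., n-1 and of s 0, ..., s (n-1). *)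
pose a : 'rV[int]_n := \row_i (i : nat)%:Z.
have detV : \det (Vandermonde n a) = \prod_(i < n) \prod_(j < n | (i < j)%N) (j%:Z - i%:Z).
  by rewrite det_Vandermonde; apply: eq_bigr => i _; apply: eq_bigr => j _; rewrite !mxE.
have detVs : (-1) ^+ s * \det (Vandermonde n a) =
    \prod_(i < n) \prod_(j < n | (i < j)%N) ((s j : nat)%:Z - (s i : nat)%:Z).
  have -> : \prod_(i < n) \prod_(j < n | (i < j)%N) ((s j : nat)%:Z - (s i : nat)%:Z) =
      \det (Vandermonde n (\row_i (s i : nat)%:Z)).
    by rewrite det_Vandermonde; apply: eq_bigr => i _; apply: eq_bigr => j _; rewrite !mxE.
  have -> : Vandermonde n (\row_i (s i : nat)%:Z) = col_perm s (Vandermonde n a).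
    by apply/matrixP => i j; rewrite !mxE.
  by rewrite col_permE det_mulmx det_perm odd_permV mulrC.
have sg_prod (f : 'I_n -> 'I_n -> int) :
    Num.sg (\prod_(i < n) \prod_(j < n | (i < j)%N) f i j) =
    \prod_(p : 'I_n * 'I_n | (p.1 < p.2)%N) Num.sg (f p.1 p.2).
  rewrite (big_morph Num.sg (@sgrM _) (@sgr1 _)).
  rewrite -(pair_big_dep predT (fun i j : 'I_n => (i < j)%N) (fun i j => Num.sg (f i j))) /=.
  by apply: eq_bigr => i _; apply: (big_morph Num.sg (@sgrM _) (@sgr1 _)).
(* Under [Num.sg] the increasing word contributes [1], and a pair of positions contributes [-1]
   exactly when it is an inversion of [s]. *)
move/(congr1 Num.sg): detVs; rewrite sgrM detV !sg_prod.
rewrite [X in _ * X]big1 => [|p ltp]; last by rewrite gtr0_sg // subr_gt0 ltz_nat.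
rewrite mulr1 (eq_bigr (fun p : 'I_n * 'I_n => (-1) ^+ (s p.2 < s p.1)%N)); last first.
  move=> [i j] /= ltij; have [ltji|leij] := ltnP.
    by rewrite ltr0_sg // subr_lt0 ltz_nat.
  rewrite gtr0_sg // subr_gt0 ltz_nat ltn_neqAle leij andbT.
  by apply: contraTneq ltij => /val_inj/perm_inj->; rewrite ltnn.
rewrite prodrXr -big_mkcondr sum1_card /= sgrX sgrN1.
rewrite -(cardsE (fun p : 'I_n * 'I_n => (p.1 < p.2)%N && (s p.2 < s p.1)%N)).
by rewrite -/(inv_num s) -[RHS]signr_odd => /signr_inj.
Qed.

Lemma sign_inv_num (R : pzRingType) n (s : 'S_n) :
  (-1) ^+ inv_num s = (-1) ^+ (s : bool) :> R.
Proof. by rewrite -signr_odd odd_inv_num. Qed.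

(* The term [i = 0] vanishes, so the convention [0.-1 = 0] is harmless. *)
Definition majf n (f : nat -> nat) : nat := (\sum_(i < n) (f i < f i.-1) * i)%N.

(** A total function on [nat], so that neighbouring positions need no bound proofs; [0] is a filler
    beyond the end. *)
Definition word n (s : 'S_n) (i : nat) : nat := oapp (fun x => val (s x)) 0%N (insub i).

Lemma wordE n (s : 'S_n) (x : 'I_n) : word s x = s x :> nat.
Proof. by rewrite /word valK. Qed.

(** A descent is indexed by its second position [j] instead of its first, [i]; the weight [i.+1] is
    then [j] itself. *)
Lemma maj_majf n (s : 'S_n) : maj s = majf n (word s).
Proof.
rewrite /maj /majf (exchange_big_dep predT) //=; apply: eq_bigr => j _.
case: n s j => [|n] s j; first by case: j.
case: (ord0 =P j) => [<-|/eqP j_neq0].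
  by rewrite big_pred0 ?muln0 // => i.
have j_gt0: (0 < j)%N by rewrite lt0n eq_sym; apply: contraNneq j_neq0 => /esym j0; apply/eqP/val_inj.
have ltj : (j.-1 < n.+1)%N by rewrite (leq_trans _ (ltn_ord j)) // ltnS leq_pred.
pose i0 : 'I_n.+1 := Ordinal ltj.
rewrite -[j.-1]/(val i0) !wordE.
rewrite big_mkcondr (big_pred1 i0) /= ?prednK //.
  by case: ifP; rewrite ?mul1n.
by move=> i /=; rewrite -val_eqE /=; lia.
Qed.

Lemma eq_majf n (f g : nat -> nat) :
  (forall i, (0 < i < n)%N -> (f i < f i.-1)%N = (g i < g i.-1)%N) -> majf n f = majf n g.
Proof.
move=> eqfg; apply: eq_bigr => -[[|i] lti] _ /=; first by rewrite !muln0.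
by rewrite eqfg.
Qed.

Lemma majfS n f : majf n.+1 f = (majf n f + (f n < f n.-1) * n)%N.
Proof. exact: big_ord_recr. Qed.

(** * Cyclic shifts of the values, and appending a maximal letter *)

(** The cycle adding [1] modulo [n.+1]; written as a [lift_perm], its sign [(-1)^n] comes from
    [odd_lift_perm]. *)
Definition rot_perm n : 'S_n.+1 := lift_perm ord_max ord0 1%g.

Lemma rot_permX n a (i : 'I_n.+1) : (rot_perm n ^+ a)%g i = ((i + a) %% n.+1)%N :> nat.
Proof.
have rot1 (k : 'I_n.+1) : rot_perm n k = (k.+1 %% n.+1)%N :> nat.
  rewrite /rot_perm; case: (unliftP ord_max k) => [j|] ->; last by rewrite lift_perm_id /= modnn.
  by rewrite lift_perm_lift perm1 lift_max /= modn_small // ltnS.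
elim: a => [|a IHa]; first by rewrite perm1 addn0 modn_small.
by rewrite expgSr permM rot1 IHa -addn1 modnDml addn1 addnS.
Qed.

Lemma maj_rot_perm n (s : 'S_n.+1) a : (a <= n)%N -> s ord_max = ord_max ->
  (maj (s * rot_perm n ^+ a)%g + a = maj s + (0 < a)%N * n.+1)%N.
Proof.
move=> le_an s_max; rewrite !maj_majf.
(* The descents lost and gained by the reduction modulo [n.+1] telescope. *)
pose wrap i := (n < word s i + a)%N : nat.
pose g := word (s * rot_perm n ^+ a)%g.
have gE i : (i < n.+1)%N -> (g i + wrap i * n.+1 = word s i + a)%N.
  move=> lti; rewrite /wrap /g -[i]/(val (Ordinal lti)) !wordE permM rot_permX.
  have := ltn_ord (s (Ordinal lti)); set x := val (s _) => ltx.
  have [lt_n|le_n] := ltnP n (x + a)%N; last by rewrite modn_small ?addn0.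
  rewrite -[in LHS](subnK lt_n) modnDr modn_small ?mul1n ?subnK //.
  by rewrite ltn_subLR //; lia.
(* The values that wrap are the [a] largest ones. *)
have sum_wrap : (\sum_(i < n.+1) wrap i = a)%N.
  transitivity (\sum_(i < n.+1) (n < i + a)%N)%N.
    rewrite [RHS](reindex_inj (@perm_inj _ s)).
    by apply: eq_bigr => i _; rewrite /wrap wordE.
  rewrite -(big_mkord predT (fun i => (n < i + a)%N : nat)).
  rewrite (@big_cat_nat _ _ _ (n.+1 - a)) ?leq_subr //=.
  rewrite big1_seq ?add0n => [|i]; last by rewrite mem_index_iota; lia.
  rewrite big_nat (eq_bigr (fun=> 1%N)) => [|i]; last by lia.
  by rewrite -big_nat sum_nat_const_nat muln1; lia.
(* Wrapped values become smaller than unwrapped ones, having been larger, so the descent indicator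
   at [i] grows by [wrap i - wrap i.-1]. Summation by parts against the weight [i] leaves the
   boundary term [m * wrap m.-1]. *)
have prefix m : (m <= n.+1)%N ->
    (majf m g + \sum_(i < m) wrap i = majf m (word s) + m * wrap m.-1)%N.
  elim: m => [|m IHm] ltm; first by rewrite /majf !big_ord0.
  rewrite !majfS big_ord_recr /=.
  case: m => [|m] in IHm ltm *; first by rewrite /majf !big_ord0; lia.
  have := IHm (ltnW ltm); have := gE _ ltm; have := gE _ (ltnW ltm).
  have : g m.+1 != g m.
    rewrite /g -[m.+1]/(val (Ordinal ltm)) -[m]/(val (Ordinal (ltnW ltm))) !wordE.
    by rewrite (inj_eq val_inj) (inj_eq perm_inj) -val_eqE /=; lia.
  have gl i (lti : (i < n.+1)%N) : (g i < n.+1)%N.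
    by rewrite /g -[i]/(val (Ordinal lti)) wordE.
  have pl i (lti : (i < n.+1)%N) : (word s i < n.+1)%N.
    by rewrite -[i]/(val (Ordinal lti)) wordE.
  have := gl _ ltm; have := gl _ (ltnW ltm); have := pl _ ltm; have := pl _ (ltnW ltm).
  rewrite /wrap /=.
  by do 2![case: ltnP => ?] => /=; do 2![case: ltnP => ?]; nia.
(* The last value is maximal, hence wraps exactly when [a > 0]. *)
have := prefix n.+1 (leqnn _); rewrite sum_wrap /wrap /=.
rewrite -[X in word s X]/(val (@ord_max n)) wordE s_max /= -[(n < n + a)%N]/(n.+1 <= n + a)%N.
have -> : (n.+1 <= n + a)%N = (0 < a)%N by lia.
rewrite -/g; lia.
Qed.
Definition append_max n (s : 'S_n) : 'S_n.+1 := extend_perm (@lift_inj _ ord_max) s.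

Lemma codom_lift n (h i : 'I_n.+1) : (i \in codom (lift h)) = (i != h).
Proof.
apply/codomP/idP => [[j ->]|]; first by rewrite eq_sym neq_lift.
by rewrite eq_sym => /unlift_some[j -> _]; exists j.
Qed.

Lemma append_max_id n (s : 'S_n) : append_max s ord_max = ord_max.
Proof. by rewrite extend_perm_out // codom_lift eqxx. Qed.

Lemma word_append_max n (s : 'S_n) (i : nat) : (i < n)%N ->
  word (append_max s) i = word s i.
Proof.
move=> lti; have -> : i = lift ord_max (Ordinal lti) :> nat by rewrite lift_max.
by rewrite wordE extend_permE !lift_max -[X in word s X]/(val (Ordinal lti)) wordE.
Qed.

Lemma maj_append_max n (s : 'S_n) : maj (append_max s) = maj s.
Proof.
rewrite !maj_majf majfS.
rewrite -[X in (word _ X < _)%N]/(val (@ord_max n)) wordE append_max_id /=.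
case: n s => [|n] s; first by rewrite muln0 addn0 /majf !big_ord0.
rewrite word_append_max // ltnNge ltnW ?addn0; last first.
  by rewrite -[X in word s X]/(val (@ord_max n)) wordE.
by apply: eq_majf => i /andP[_ lti]; rewrite !word_append_max // (leq_ltn_trans (leq_pred i)).
Qed.

(** * The signed major index sum over all permutations *)

Section SignedMahonian.
Variables (F : fieldType) (q : F).

Definition signed_mahonian n : F := \sum_(s : 'S_n) (-1) ^+ (s : bool) * q ^+ maj s.

Lemma signed_mahonianS n :
  signed_mahonian n.+1 = signed_mahonian n * \sum_(a < n.+1) ((-1) ^+ n * q) ^+ a.
Proof.
rewrite /signed_mahonian (partition_big (fun s : 'S_n.+1 => s ord_max) predT) //=.
(* Each last value is the image of [ord_max] under exactly one power [a <= n] of the rotation;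
   translating by that power leads back to permutations fixing the last point. *)
have rot_inj : injective (fun a : 'I_n.+1 => (rot_perm n ^+ a)%g ord_max).
  move=> a b /(congr1 val) /=; rewrite !rot_permX => /eqP.
  by rewrite eqn_modDl !modn_small // => /eqP/val_inj.
rewrite (reindex_inj rot_inj) /=.
pose x := (-1) ^+ n * q.
have rot_sum (a : 'I_n.+1) :
    \sum_(s : 'S_n.+1 | s ord_max == (rot_perm n ^+ a)%g ord_max) (-1) ^+ (s : bool) * q ^+ maj s
    = signed_mahonian n * x ^+ (if a == 0%N :> nat then 0%N else n.+1 - a)%N.
  rewrite (reindex_inj (mulIg (rot_perm n ^+ a)%g)) /=.
  rewrite (eq_bigl (fun s : 'S_n.+1 => s ord_max == ord_max)); last first.
    by move=> s; rewrite permM (inj_eq perm_inj).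
  rewrite (big_extend_perm (@lift_inj _ ord_max)); last first.
    by move=> p /eqP p_max y; rewrite codom_lift negbK => /eqP->.
  rewrite mulr_suml; apply: eq_big => [s|s _]; first by rewrite append_max_id eqxx.
  rewrite -[X in (X * _)%g]/(append_max s).
  have := @maj_rot_perm n (append_max s) a (leq_ord a) (append_max_id s).
  rewrite maj_append_max odd_permM odd_extend_perm.
  have -> : odd_perm (rot_perm n ^+ a)%g = odd (n * a).
    have -> : odd_perm (rot_perm n ^+ a)%g = odd_perm (rot_perm n) && odd a.
      elim: (a : nat) => [|k IHk]; first by rewrite odd_perm1 andbF.
      by rewrite expgSr odd_permM IHk /=; case: odd_perm => //=; case: odd.
    by rewrite /rot_perm odd_lift_perm odd_perm1 /= !addbF oddM.
  rewrite signr_addb signr_odd /x; case: (val a =P 0%N) => [->|/eqP a_neq0].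
    by rewrite !addn0 => ->; rewrite muln0 !mulr1.
  rewrite lt0n a_neq0 mul1n => majE.
  have -> : maj (append_max s * rot_perm n ^+ a)%g = (maj s + (n.+1 - a))%N.
    by apply: (@addIn a); rewrite majE -addnA subnK // ltnW.
  rewrite exprMn exprD -!mulrA; congr (_ * _); rewrite mulrCA; congr (_ * (_ * _)).
  (* The signs for [n * a] and [n * (n.+1 - a)] agree because [n * n.+1] is even. *)
  rewrite -exprM -signr_odd -[RHS]signr_odd; congr (_ ^+ nat_of_bool _).
  by rewrite !oddM oddB ?(ltnW (ltn_ord a)) //=; case: odd.
rewrite (eq_bigr _ (fun a _ => rot_sum a)) -mulr_sumr; congr (_ * _).
(* The exponents are [0] for [a = 0] and then [n, ..., 1]; reversing the latter gives the geometric
   sum. *)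
rewrite big_ord_recl [RHS]big_ord_recl /=; congr (_ + _).
rewrite (reindex_inj rev_ord_inj) /=; apply: eq_bigr => i _.
by rewrite /bump /= !add1n subSS subKn.
Qed.

Hypothesis qint_neq0 : forall m, qint q m != 0.

Lemma qfactS n : qfact q n.+1 = qfact q n * qint q n.+1.
Proof. by rewrite /qfact big_nat_recr. Qed.

Lemma qfact0 : qfact q 0 = 1.
Proof. by rewrite /qfact big_geq. Qed.

Lemma qfact_neq0 n : qfact q n != 0.
Proof. by elim: n => [|n IHn]; rewrite ?qfact0 ?oner_neq0 // qfactS mulf_neq0. Qed.

Lemma qintE m : (1 - q) * qint q m.+1 = 1 - q ^+ m.+1.
Proof. by rewrite /qint /= -[in RHS](expr1n _ m.+1) subrXX; congr (_ * _); apply: eq_bigr => i _; rewrite expr1n mul1r. Qed.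

(** The factor added at step [n.+1] is [qint q n.+1] for even [n]. For odd [n] it is the geometric
    sum in [- q], equal to [qint q n.+1 * (1 - q) / (1 + q)], and that is when [n.+1 %/ 2]
    increases. *)
Lemma signed_mahonianE n :
  signed_mahonian n = qfact q n * ((1 - q) / (1 + q)) ^+ (n %/ 2).
Proof.
have q1_neq0 : 1 + q != 0.
  by have := qint_neq0 2; rewrite /qint /= !big_ord_recl big_ord0 addr0.
elim: n => [|n IHn].
  rewrite /signed_mahonian (big_pred1 1%g).
    by rewrite odd_perm1 mul1r qfact0 mul1r /maj big_ord0.
  by move=> s; apply/esym/eqP/permP => -[].
rewrite signed_mahonianS {}IHn qfactS -!mulrA; congr (_ * _).
rewrite -signr_odd !divn2 /= uphalf_half.
case: (boolP (odd n)) => /= [odd_n|_]; last first.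
  rewrite add0n mulrC; congr (_ * _).
  by apply: eq_bigr => i _; rewrite mul1r.
rewrite expr1 mulN1r exprD expr1 mulrA [LHS]mulrC; congr (_ * _).
have q_sum : (1 + q) * \sum_(a < n.+1) (- q) ^+ a = (1 - q) * qint q n.+1.
  have -> : (1 - q) * qint q n.+1 = 1 ^+ n.+1 - (- q) ^+ n.+1.
    by rewrite qintE expr1n exprNn -signr_odd /= odd_n mul1r.
  rewrite subrXX opprK; congr (_ * _).
  by apply: eq_bigr => i _; rewrite expr1n mul1r.
by apply: (mulfI q1_neq0); rewrite q_sum; field.
Qed.

End SignedMahonian.

(** * The q-binomial coefficients and their Pascal rules *)

Section QBinomial.
Variables (F : fieldType) (q : F).
Hypothesis qint_neq0 : forall m, qint q m != 0.

(** The value [0] for [k > n] lets both Pascal rules hold without a bound on [k]. *)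
Definition qbin n k : F := if (k <= n)%N then qfact q n / (qfact q k * qfact q (n - k)) else 0.

(** Both arguments are successors because the convention [qint q 0 = 1] breaks the identity at
    [0]. *)
Lemma qintD m k : qint q (m.+1 + k.+1) = qint q m.+1 + q ^+ m.+1 * qint q k.+1.
Proof.
rewrite /qint addSn /= -addSn big_split_ord /= big_distrr /=; congr (_ + _).
by apply: eq_bigr => i _; rewrite exprD.
Qed.

Lemma qbin_small n k : (n < k)%N -> qbin n k = 0.
Proof. by rewrite /qbin ltnNge => /negPf->. Qed.

Lemma qbinn n : qbin n n = 1.
Proof. by rewrite /qbin leqnn subnn qfact0 mulr1 divff // qfact_neq0. Qed.

Lemma qbin0 n : qbin n 0 = 1.
Proof. by rewrite /qbin subn0 qfact0 mul1r divff // qfact_neq0. Qed.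

Lemma qbinD k m : qbin (k + m) k = qfact q (k + m) / (qfact q k * qfact q m).
Proof. by rewrite /qbin leq_addr addKn. Qed.

(** For [n = k.+1 + m], this comes from splitting [qint q n.+1] with [k.+1] terms first; the
    symmetric rule below puts [m.+1] terms first. *)
Lemma qbinS n k : qbin n.+1 k.+1 = qbin n k + q ^+ k.+1 * qbin n k.+1.
Proof.
have [lt_nk|lt_kn|->] := ltngtP n k; last by rewrite !qbinn qbin_small // mulr0 addr0.
  by rewrite !qbin_small ?mulr0 ?addr0 // ltnW.
have {lt_kn} [m ->] : exists m, n = (k.+1 + m)%N by exists (n - k.+1)%N; rewrite subnKC.
rewrite -addnS qbinD addnS qfactS -addnS qintD [in qbin _ k]addSnnS !qbinD -addSnnS.
set N := qfact q (k.+1 + m); rewrite !qfactS.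
by field; rewrite !(qfact_neq0 qint_neq0) !qint_neq0.
Qed.

Lemma qbinS_sym n k : qbin n.+1 k.+1 = q ^+ (n - k) * qbin n k + qbin n k.+1.
Proof.
have [lt_nk|lt_kn|->] := ltngtP n k; last by rewrite subnn mul1r !qbinn qbin_small // addr0.
  by rewrite !qbin_small ?mulr0 ?addr0 // ltnW.
have {lt_kn} [m ->] : exists m, n = (k.+1 + m)%N by exists (n - k.+1)%N; rewrite subnKC.
rewrite -addnS qbinD addnS qfactS -addnS [(k.+1 + m.+1)%N]addnC qintD.
rewrite [in X in (X - k)%N]addSnnS addKn [in qbin _ k]addSnnS !qbinD -addSnnS.
set N := qfact q (k.+1 + m); rewrite !qfactS.
by field; rewrite !(qfact_neq0 qint_neq0) !qint_neq0.
Qed.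

(** * Major index of shuffles with a constant word *)

Section Shuffle.
Variables (u : nat -> nat) (z : nat).

Definition memn n (A : {set 'I_n}) (i : nat) : bool := oapp (fun x => x \in A) false (insub i).

Definition rankn n (A : {set 'I_n}) (i : nat) : nat := (\sum_(j < i) memn A j)%N.

(** The shuffle of [u] with a constant word in [z], encoded by the set [A] of positions that the
    letters of [u] take in order. *)
Definition shuffle n (A : {set 'I_n}) (i : nat) : nat := if memn A i then u (rankn A i) else z.

Definition extend_set n (c : bool) (B : {set 'I_n}) : {set 'I_n.+1} :=
  [set i | oapp (fun j => j \in B) c (unlift ord_max i)].

Lemma memnE n (A : {set 'I_n}) (i : 'I_n) : memn A i = (i \in A).
Proof. by rewrite /memn valK. Qed.

Lemma rankn_card n (A : {set 'I_n}) : rankn A n = #|A|.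
Proof.
rewrite -sum1_card big_mkcond /=; apply: eq_bigr => i _.
by rewrite memnE; case: (i \in A).
Qed.

Lemma memn_extend_lt n c (B : {set 'I_n}) i : (i < n)%N -> memn (extend_set c B) i = memn B i.
Proof.
move=> lti; rewrite -[i]/(val (Ordinal lti)) memnE.
by rewrite -[val _]/(nat_of_ord (Ordinal lti)) -lift_max memnE inE liftK.
Qed.

Lemma memn_extend_max n c (B : {set 'I_n}) : memn (extend_set c B) n = c.
Proof. by rewrite -[n in X in X = _]/(val (@ord_max n)) memnE inE unlift_none. Qed.

Lemma rankn_extend n c (B : {set 'I_n}) i : (i <= n)%N -> rankn (extend_set c B) i = rankn B i.
Proof. by move=> lei; apply: eq_bigr => j _; rewrite memn_extend_lt // (leq_trans (ltn_ord j)). Qed.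

Lemma card_extend_set n c (B : {set 'I_n}) : #|extend_set c B| = (#|B| + c)%N.
Proof.
by rewrite -!rankn_card [LHS]big_ord_recr memn_extend_max /= -/(rankn _ _) rankn_extend.
Qed.

Lemma big_set_ordS n (f : {set 'I_n.+1} -> F) :
  \sum_A f A = \sum_(B : {set 'I_n}) f (extend_set true B) + \sum_(B : {set 'I_n}) f (extend_set false B).
Proof.
pose h (p : bool * {set 'I_n}) := extend_set p.1 p.2.
rewrite (reindex h) /=.
  by rewrite -(pair_bigA _ (fun c B => f (extend_set c B))) /= big_bool.
exists (fun A : {set 'I_n.+1} => (ord_max \in A, [set j | lift ord_max j \in A])).
  move=> [c B] _ /=; rewrite /h inE unlift_none /=; congr pair.
  by apply/setP => j; rewrite !inE liftK.
move=> A _; apply/setP => i; rewrite inE /=.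
by case: unliftP => [j|] -> /=; rewrite ?inE.
Qed.

Lemma majf_extend n c (B : {set 'I_n}) :
  majf n.+1 (shuffle (extend_set c B)) =
  (majf n (shuffle B) +
   ((if c then u #|B| else z) < (if memn B n.-1 then u #|B|.-1 else z))%N * n)%N.
Proof.
rewrite majfS; congr (_ + _)%N.
  apply: eq_majf => i /andP[_ lti]; rewrite /shuffle !memn_extend_lt ?(leq_ltn_trans (leq_pred i)) //.
  have le_in := ltnW lti; have le_pn := leq_trans (leq_pred i) le_in.
  by rewrite (rankn_extend _ _ le_in) (rankn_extend _ _ le_pn).
(* For [n = 0] there is no previous letter, but the weight is [0]. *)
case: n B => [|n] B; first by rewrite !muln0.
rewrite /shuffle memn_extend_max rankn_extend // rankn_card /= memn_extend_lt //.
rewrite rankn_extend // -rankn_card [rankn B n.+1]big_ord_recr /= -/(rankn _ _).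
by case: (memn B n); rewrite ?addn1.
Qed.

(** The flag [c] records whether the last letter comes from [u]: with the size of [A], it determines
    that letter, hence whether the next one creates a descent. The empty word has flag [false]. *)
Definition shuffle_sum c n k : F :=
  \sum_(A : {set 'I_n} | (#|A| == k) && (memn A n.-1 == c)) q ^+ majf n (shuffle A).

Lemma shuffle_sum_true0 n : shuffle_sum true n.+1 0 = 0.
Proof.
apply: big_pred0 => A; apply/negbTE/negP => /andP[/eqP/cards0_eq->].
by rewrite -[n.+1.-1]/(val (@ord_max n)) memnE inE.
Qed.

Lemma shuffle_sum_false n k :
  shuffle_sum false n.+1 k =
  q ^+ ((z < u k.-1)%N * n) * shuffle_sum true n k + shuffle_sum false n k.
Proof.
rewrite /shuffle_sum big_mkcond big_set_ordS big1 ?add0r => [|B _]; last first.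
  by rewrite memn_extend_max andbF.
rewrite -big_mkcond /= (eq_bigl (fun B : {set 'I_n} => #|B| == k)); last first.
  by move=> B; rewrite memn_extend_max card_extend_set addn0 eqxx andbT.
rewrite (bigID (fun B => memn B n.-1)) /=; congr (_ + _).
  rewrite mulr_sumr; apply: eq_big => [B|B /andP[/eqP cB mB]]; first by rewrite eqb_id.
  by rewrite majf_extend mB cB exprD mulrC.
apply: eq_big => [B|B /andP[/eqP cB mB]]; first by rewrite eqbF_neg.
by rewrite majf_extend (negPf mB) ltnn addn0.
Qed.

Lemma shuffle_sum_true n k :
  shuffle_sum true n.+1 k.+1 =
  q ^+ ((u k < u k.-1)%N * n) * shuffle_sum true n k +
  q ^+ ((u k < z)%N * n) * shuffle_sum false n k.
Proof.
rewrite /shuffle_sum big_mkcond big_set_ordS addrC big1 ?add0r => [|B _]; last first.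
  by rewrite memn_extend_max andbF.
rewrite -big_mkcond /= (eq_bigl (fun B : {set 'I_n} => #|B| == k)); last first.
  by move=> B; rewrite memn_extend_max card_extend_set addn1 eqSS eqxx andbT.
rewrite (bigID (fun B => memn B n.-1)) /=; congr (_ + _).
  rewrite mulr_sumr; apply: eq_big => [B|B /andP[/eqP cB mB]]; first by rewrite eqb_id.
  by rewrite majf_extend mB cB exprD mulrC.
rewrite mulr_sumr; apply: eq_big => [B|B /andP[/eqP cB mB]]; first by rewrite eqbF_neg.
by rewrite majf_extend (negPf mB) cB exprD mulrC.
Qed.

Lemma shuffle_sum_nil c k : shuffle_sum c 0 k = (~~ c && (k == 0%N))%:R.
Proof.
have set0E (A : {set 'I_0}) : A = set0 by apply/setP => -[].
rewrite /shuffle_sum; case: (boolP (~~ c && (k == 0%N))) => [/andP[/negPf-> /eqP->]|nck].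
  rewrite (big_pred1 set0) => [|A]; first by rewrite /majf big_ord0 expr0.
  by rewrite (set0E A) cards0 /memn insubN //= !eqxx.
rewrite big_pred0 // => A; apply: contraNF nck.
by rewrite (set0E A) cards0 /memn insubN //= eq_sym [_ == c]eq_sym eqbF_neg andbC.
Qed.

Lemma qbin_exprB n k : q ^+ (n - k) * q ^+ k.+1 * qbin n k = q ^+ n.+1 * qbin n k.
Proof.
have [lt_nk|le_kn] := ltnP n k; first by rewrite qbin_small // !mulr0.
by rewrite -exprD addnS subnK.
Qed.

(** Joint induction on [n] for both flags, through the recursions on the last letter. The extra
    powers of [q] are the weights in the two Pascal rules, selected by comparing [z] with the last
    letter of [u]. *)
Lemma shuffle_sumE n k : (forall j, (j < k)%N -> u j != z) ->
  shuffle_sum false n.+1 k = q ^+ majf k u * q ^+ (((0 < k) && (z < u k.-1)) * k)%N * qbin n k /\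
  shuffle_sum true n.+1 k =
    if k is k'.+1 then q ^+ majf k u * q ^+ ((u k' < z) * (n - k'))%N * qbin n k' else 0.
Proof.
elim: n k => [|n IHn] k uz.
  split.
    rewrite shuffle_sum_false !shuffle_sum_nil mulr0 add0r.
    case: k uz => [|k] _; last by rewrite qbin_small // !mulr0.
    by rewrite qbin0 /majf big_ord0 !mulr1.
  case: k uz => [|k] _; first exact: shuffle_sum_true0.
  rewrite shuffle_sum_true !shuffle_sum_nil mulr0 add0r muln0 mul1r.
  case: k => [|k]; last by rewrite qbin_small // !mulr0.
  by rewrite majfS /majf big_ord0 muln0 qbin0 !mulr1.
have [IHf IHt] := IHn k uz; split.
  rewrite shuffle_sum_false IHf IHt.
  case: k uz {IHf IHt} => [|k] uz; first by rewrite mulr0 add0r !qbin0.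
  have := uz k (ltnSn k); rewrite -mulrA mulrCA -[q ^+ majf _ _ * _ * _]mulrA -mulrDr -[RHS]mulrA /=.
  case: ltngtP => //= _ _; congr (_ * _); rewrite !(mul0n, mul1n, expr0, mul1r).
    by rewrite qbinS_sym mulrDr -qbin_exprB; ring.
  by rewrite qbinS_sym.
case: k uz {IHf IHt} => [|k] uz; first exact: shuffle_sum_true0.
have uzk j : (j < k)%N -> u j != z by move=> ltj; apply: uz; apply: ltnW.
rewrite shuffle_sum_true; have [-> ->] := IHn k uzk.
case: k uz uzk => [|k] uz uzk.
  by rewrite mulr0 add0r majfS !muln0 addn0 /= !qbin0 !mulr1 mulrC subn0.
have := uz k (ltnW (ltnSn _)); have := uz k.+1 (ltnSn _).
rewrite [majf k.+2 u]majfS exprD subSS /= qbinS_sym => /eqP xz /eqP yz.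
have [lt_nk|le_kn] := ltnP n k; first by rewrite !qbin_small ?mulr0 ?addr0 ?mulr0 // ltnW.
(* Depending on the relative order of [u k], [u k.+1] and [z], the recursion yields one Pascal
   expansion or the other; inconsistent orders are left to [lia]. *)
have pascal : q ^+ (n - k) * qbin n k + qbin n k.+1 = qbin n k + q ^+ k.+1 * qbin n k.+1.
  by rewrite -qbinS_sym qbinS.
have -> : n.+1 = (n - k + k.+1)%N by lia.
have -> : (z < u k)%N = ~~ (u k < z)%N by lia.
move: pascal; rewrite !mulnDr !exprD.
by case: (ltnP (u k.+1) z); case: (ltnP (u k) z); case: (ltnP (u k.+1) (u k));
  rewrite /= ?mul1n ?mul0n ?expr0 => ? ? ? pascal; try lia; try ring; rewrite pascal; ring.
Qed.

(** Adding the closed forms for the two flags gives one of the Pascal rules: [qbinS_sym] if the last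
    letter of [u] is below [z], [qbinS] if it is above. *)
Lemma sum_shuffle n k : (forall j, (j < k)%N -> u j != z) ->
  \sum_(A : {set 'I_n} | #|A| == k) q ^+ majf n (shuffle A) = q ^+ majf k u * qbin n k.
Proof.
move=> uz; have -> : \sum_(A : {set 'I_n} | #|A| == k) q ^+ majf n (shuffle A) =
    shuffle_sum true n k + shuffle_sum false n k.
  rewrite (bigID (fun A => memn A n.-1)) /=.
  by congr (_ + _); apply: eq_bigl => A; rewrite ?eqb_id ?eqbF_neg.
case: n => [|n].
  rewrite !shuffle_sum_nil add0r; case: k uz => [|k] _; last by rewrite qbin_small // mulr0.
  by rewrite qbin0 /majf big_ord0 mulr1.
have [-> ->] := shuffle_sumE n uz.
case: k uz => [|k] uz; first by rewrite add0r !qbin0 mulr1.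
move/(_ k (ltnSn k))/eqP: uz => /= yz; rewrite -!mulrA -mulrDr; congr (_ * _).
case: (ltngtP (u k) z) yz => //= _ _; rewrite ?mul1n ?mul0n ?expr0 ?mul1r.
  by rewrite qbinS_sym.
by rewrite qbinS.
Qed.

End Shuffle.
End QBinomial.

(** * From a derangement to the shuffled word *)

Section DerangementWord.
Variables (k : nat) (s : 'S_k).
Hypothesis s_der : derangement s.

(* Subexcedances become letters below [k], excedances letters above [k]; the
   letter [k] stands for the fixed points. *)
Definition letter (j : nat) : nat := if (word s j < j)%N then word s j else (word s j + k.+1)%N.

Lemma letter_neq j : (j < k)%N -> letter j != k.
Proof. by rewrite /letter => ltj; case: ifP => lts; rewrite neq_ltn; lia. Qed.

Lemma derangement_neq (j : 'I_k) : s j != j :> nat.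
Proof. by move/forallP: s_der => /(_ j); rewrite -val_eqE. Qed.

(** Adjacency is essential: if [i] carries a small letter and [j] a big one, then [s i <= j < s j];
    in the opposite case [s j < j < i < s i]. So separating small from big letters preserves the
    comparison. *)
Lemma letter_lt (i j : 'I_k) : i = j.+1 :> nat -> (letter i < letter j)%N = (s i < s j)%N.
Proof.
move=> eq_ij; rewrite /letter !wordE.
have := derangement_neq i; have := derangement_neq j.
have := ltn_ord (s i); have := ltn_ord (s j).
by case: ifP; case: ifP; lia.
Qed.

Lemma majf_letter : majf k letter = maj s.
Proof.
rewrite maj_majf; apply: eq_majf => i /andP[i_gt0 lti].
have ltp : (i.-1 < k)%N by apply: leq_ltn_trans (leq_pred i) lti.
have -> := @letter_lt (Ordinal lti) (Ordinal ltp); last by rewrite /= prednK.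
by rewrite -!wordE.
Qed.

Section Embedding.
Variables (n : nat) (e : 'I_k -> 'I_n) (A : {set 'I_n}).
Hypothesis e_mono : forall i j, (e i < e j)%N = (i < j)%N.
Hypothesis e_inj : injective e.
Hypothesis A_def : A = e @: [set: 'I_k].

Lemma rankn_embed r : rankn A (e r) = r.
Proof.
rewrite /rankn (big_ord_widen n (fun j => memn A j : nat)) ?(ltnW (ltn_ord _)) //.
transitivity (\sum_(j in A | (j < e r)%N) 1)%N.
  rewrite [RHS]big_mkcondl; apply: eq_bigr => j _.
  by rewrite memnE; case: (j \in A).
rewrite A_def big_imset_cond /=; last by move=> i j _ _; apply: e_inj.
rewrite (eq_bigl (fun j : 'I_k => j < r)%N) => [|j]; last by rewrite inE e_mono.
by rewrite -(big_ord_widen k (fun=> 1%N)) ?(ltnW (ltn_ord _)) // sum_nat_const card_ord muln1.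
Qed.

Lemma mem_embed r : e r \in A.
Proof. by rewrite A_def imset_f. Qed.

Lemma shuffle_embed r : shuffle letter k A (e r) = letter r.
Proof. by rewrite /shuffle memnE mem_embed rankn_embed. Qed.

Lemma shuffle_out (i : 'I_n) : i \notin A -> shuffle letter k A i = k.
Proof. by rewrite /shuffle memnE => /negPf->. Qed.

Lemma extend_perm_outA (i : 'I_n) : i \notin A -> extend_perm e_inj s i = i.
Proof.
move=> iA; apply: extend_perm_out; apply: contra iA => /codomP[r ->].
exact: mem_embed.
Qed.

(** The two words have the same descents. Next to a fixed point [x], a value [e (s r)] differs from
    [x], so it lies below [x] exactly when it lies below its own position [e r], that is, when its
    letter is below [k]. *)
Lemma maj_extend_perm : maj (extend_perm e_inj s) = majf n (shuffle letter k A).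
Proof.
rewrite maj_majf; apply: eq_majf => i /andP[i_gt0 lti].
have ltp : (i.-1 < n)%N by apply: leq_ltn_trans (leq_pred i) lti.
have : Ordinal lti = (Ordinal ltp).+1 :> nat by rewrite /= prednK.
rewrite -[i]/(val (Ordinal lti)) -[i.-1]/(val (Ordinal ltp)).
move: (Ordinal lti) (Ordinal ltp) => {i i_gt0 lti ltp} i j /= eq_ij; rewrite !wordE.
have inA x : x \in A -> exists r, x = e r by rewrite A_def => /imsetP[r _ ->]; exists r.
have notA x r : x \notin A -> e r != x :> nat.
  by move=> xA; rewrite (inj_eq val_inj); apply: contraNneq xA => <-; apply: mem_embed.
have extE r : extend_perm e_inj s (e r) = e (s r) by apply: extend_permE.
have [iA|iA] := boolP (i \in A); have [jA|jA] := boolP (j \in A).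
- have [[r def_i] [t def_j]] := (inA _ iA, inA _ jA); subst i j.
  rewrite !extE !shuffle_embed e_mono letter_lt //.
  (* Adjacent positions of [A] have consecutive ranks, as [letter_lt] requires. *)
  by rewrite -[LHS]rankn_embed eq_ij [LHS]big_ord_recr /= -/(rankn _ _) rankn_embed memnE jA addn1.
- have [r def_i] := inA _ iA; subst i.
  rewrite extE extend_perm_outA // shuffle_embed shuffle_out //.
  have := notA _ (s r) jA; have := derangement_neq r; have := e_mono (s r) r.
  by rewrite /letter wordE /=; have := ltn_ord (s r); case: ifP; lia.
- have [t def_j] := inA _ jA; subst j.
  rewrite extE extend_perm_outA // shuffle_embed shuffle_out //.
  have := notA _ (s t) iA; have := derangement_neq t; have := e_mono (s t) t; have := e_mono t (s t).
  by rewrite /letter wordE /=; have := ltn_ord (s t); case: ifP; lia.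
by rewrite !extend_perm_outA // !shuffle_out // eq_ij ltnn ltnNge leqnSn.
Qed.

End Embedding.
End DerangementWord.

(** * Decomposition by support and q-binomial inversion *)

Section Inversion.
Variables (F : fieldType) (q : F).
Hypothesis qint_neq0 : forall m, qint q m != 0.

Definition signed_derangement n : F :=
  \sum_(s : 'S_n | derangement s) (-1) ^+ (s : bool) * q ^+ maj s.

Lemma signed_mahonian_derangement n :
  signed_mahonian q n = \sum_(k < n.+1) qbin q n k * signed_derangement k.
Proof.
pose supp (s : 'S_n) := [set i | s i != i].
(* The size [k] is kept separate from [#|A|], so that after grouping supports by size the type
   ['S_k] no longer depends on [A]. *)
pose w (A : {set 'I_n}) k := \sum_(s : 'S_k | derangement s)
  (-1) ^+ (s : bool) * q ^+ majf n (shuffle (letter s) k A).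
rewrite /signed_mahonian (partition_big supp predT) //=.
transitivity (\sum_(A : {set 'I_n}) w A #|A|).
  apply: eq_bigr => A _.
  pose e : 'I_#|A| -> 'I_n := Order.enum_val.
  have e_inj : injective e by apply: Order.EnumVal.enum_val_inj.
  have e_mono i j : (e i < e j)%N = (i < j)%N.
    rewrite !ltnNge; congr (~~ _).
    exact: (Order.EnumVal.le_enum_val (@le_total _ 'I_n)).
  have A_def : A = e @: [set: 'I_#|A|].
    apply/setP => i; apply/idP/imsetP => [iA|[r _ ->]]; last exact: Order.EnumVal.enum_valP.
    by exists (Order.enum_rank_in iA i) => //; rewrite /e Order.EnumVal.enum_rankK_in.
  have e_codom i : (i \in codom e) = (i \in A).
    by rewrite [in RHS]A_def; apply/codomP/imsetP => [[r ->]|[r _ ->]]; exists r.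
  rewrite (big_extend_perm e_inj); last first.
    move=> p /eqP suppA y; rewrite e_codom => yA; apply/eqP.
    by move: yA; rewrite -[in y \notin A]suppA inE negbK.
  have supp_extend (s : 'S_#|A|) : (supp (extend_perm e_inj s) == A) = derangement s.
    apply/eqP/forallP => [suppA r | s_der].
      have : e r \in A by rewrite -e_codom codom_f.
      by rewrite -[in _ \in A]suppA inE extend_permE (inj_eq e_inj).
    apply/setP => i; rewrite inE -e_codom.
    have [/codomP[r ->]|i_out] := boolP (i \in codom e).
      by rewrite extend_permE (inj_eq e_inj) s_der.
    by rewrite extend_perm_out // eqxx.
  apply: eq_big => [s|s]; rewrite supp_extend // => s_der.
  by rewrite odd_extend_perm (maj_extend_perm s_der e_mono e_inj A_def).
rewrite (partition_big (fun A : {set 'I_n} => inord #|A| : 'I_n.+1) predT) //=.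
apply: eq_bigr => k _.
have inordE (A : {set 'I_n}) : (inord #|A| == k) = (#|A| == k :> nat).
  by rewrite -val_eqE /= inordK // ltnS -[X in (_ <= X)%N](card_ord n) max_card.
rewrite (eq_bigl _ _ inordE) (eq_bigr (fun A => w A k)) => [|A /eqP->//].
rewrite exchange_big /= mulr_sumr; apply: eq_bigr => s s_der.
rewrite -mulr_sumr (sum_shuffle qint_neq0); last by move=> j; apply: letter_neq.
by rewrite majf_letter // mulrA mulrC.
Qed.

(** An instance of the q-binomial theorem. For [m.+1], [qbinS] and
    ['C(k.+2, 2) = 'C(k.+1, 2) + k.+1] make the terms after the first telescope to [-1]. *)
Lemma qbin_alternating m :
  \sum_(k < m.+1) (-1) ^+ k * q ^+ 'C(k, 2) * qbin q m k = (m == 0%N)%:R.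
Proof.
case: m => [|m]; first by rewrite big_ord1 !mul1r qbin0.
pose t k := (-1) ^+ k * q ^+ 'C(k.+1, 2) * qbin q m k.
rewrite big_ord_recl mul1r mul1r (qbin0 qint_neq0).
rewrite (eq_bigr (fun k : 'I_m.+1 => t k.+1 - t k)) => [|k _]; last first.
  rewrite /t lift0 (qbinS qint_neq0) exprS [in RHS]binS bin1 exprD exprS.
  ring.
rewrite -(big_mkord predT (fun k => t k.+1 - t k)) telescope_sumr //.
by rewrite /t qbin_small // mulr0 sub0r bin_small // !mul1r (qbin0 qint_neq0) subrr.
Qed.

Lemma signed_derangementE n :
  signed_derangement n = qfact q n * \sum_(k < n.+1)
    ((-1) ^+ k * q ^+ 'C(k, 2) / qfact q k) * (signed_mahonian q (n - k) / qfact q (n - k)).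
Proof.
have fact_neq0 := qfact_neq0 qint_neq0.
(* [E * (H * D) = (E * H) * D], read in degree [n]; [E * H] is [1] up to degree [n]. *)
pose E := \poly_(k < n.+1) ((-1) ^+ k * q ^+ 'C(k, 2) / qfact q k).
pose H := \poly_(k < n.+1) (qfact q k)^-1.
pose D := \poly_(k < n.+1) (signed_derangement k / qfact q k).
(* Multiplied by [qfact q m], this is [qbin_alternating]. *)
have EH m : (m <= n)%N -> (E * H)`_m = (m == 0%N)%:R.
  move=> le_mn; apply: (mulfI (fact_neq0 m)); rewrite coefM mulr_sumr.
  transitivity ((m == 0%N)%:R : F); last first.
    by case: m {le_mn} => [|m]; rewrite ?mulr0 // qfact0 mulr1.
  rewrite -qbin_alternating; apply: eq_bigr => k _.
  rewrite !coef_poly !ltnS (leq_trans (leq_ord k) le_mn) (leq_trans (leq_subr _ _) le_mn).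
  by rewrite /qbin leq_ord; field; rewrite !fact_neq0.
(* This is [signed_mahonian_derangement] divided by [qfact q m]. *)
have HD m : (m <= n)%N -> (H * D)`_m = signed_mahonian q m / qfact q m.
  move=> le_mn; rewrite mulrC signed_mahonian_derangement mulr_suml coefM.
  apply: eq_bigr => k _.
  rewrite !coef_poly !ltnS (leq_trans (leq_ord k) le_mn) (leq_trans (leq_subr _ _) le_mn).
  by rewrite /qbin leq_ord; field; rewrite !fact_neq0.
have Dn : (E * H * D)`_n = signed_derangement n / qfact q n.
  rewrite coefM big_ord_recl EH // mul1r subn0 coef_poly ltnSn big1 ?addr0 // => k _.
  by rewrite lift0 EH ?mul0r.
rewrite -[LHS](divfK (fact_neq0 n)) -Dn mulrC; congr (_ * _).
rewrite -mulrA coefM; apply: eq_bigr => k _.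
by rewrite HD ?leq_subr // coef_poly ltn_ord.
Qed.

End Inversion.

(** * Specialisation to rational functions *)

(** For [m > 0] the underlying polynomial takes the value [m] at [1], which is nonzero in [rat]. *)
Lemma qint_qX_neq0 m : qint qX m != 0.
Proof.
rewrite /qint; case: (m =P 0%N) => [_|/eqP m_neq0]; first exact: oner_neq0.
have -> : \sum_(i < m) qX ^+ i = tofrac (\sum_(i < m) 'X^i : {poly rat}).
  by rewrite rmorph_sum; apply: eq_bigr => i _; rewrite rmorphXn.
rewrite tofrac_eq0; apply: contraNneq m_neq0 => /(congr1 (horner^~ 1)).
rewrite horner_sum horner0 (eq_bigr (fun=> 1)) => [|i _]; last by rewrite hornerXn expr1n.
by rewrite sumr_const card_ord => /eqP; rewrite pnatr_eq0.
Qed.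

Theorem theorem2p4 (n : nat) : (1 <= n)%N ->
  \sum_(s : 'S_n | derangement s) (-1) ^+ inv_num s * qX ^+ maj s
  = qfact qX n *
    \sum_(0 <= k < n.+1)
      ((-1) ^+ k * qX ^+ 'C(k, 2) / qfact qX k)
      * ((1 - qX) / (1 + qX)) ^+ ((n - k) %/ 2).
Proof.
move=> _; rewrite (eq_bigr _ (fun s _ => congr1 (fun x => x * _) (sign_inv_num _ s))).
rewrite -[LHS]/(signed_derangement qX n) (signed_derangementE qint_qX_neq0) big_mkord.
congr (_ * _); apply: eq_bigr => k _; congr (_ * _).
by rewrite (signed_mahonianE qint_qX_neq0) mulrC mulKf // (qfact_neq0 qint_qX_neq0).
Qed.
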